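(* Let $n\ge 1$ and let $B_{n+1}^+$ be the braid semigroup with generators $a_1,\dots,a_n$. With respect to the deg-lex order on words with $a_1<a_2<\dots<a_n$, a Gröbner-Shirshov basis of $B_{n+1}^+$ consists of the following relations: $$a_{i+1}a_i\,V(1,i-1)\,W(j,i)\,a_{i+1\,j}=a_i a_{i+1}a_i\,V(1,i-1)\,a_{ij}\,W'(j+1,i+1),$$ for all $1\le i\le n-1$, all $1\le j\le i+1$, every word $V(1,i-1)$ in the letters $a_1,\dots,a_{i-1}$, and every word $W(j,i)$ in the letters $a_j,\dots,a_i$ that is either empty or begins with $a_i$, where $W'(j+1,i+1)$ is the word obtained from $W(j,i)$ by replacing each letter $a_k$ by $a_{k+1}$; together with $$a_s a_k=a_k a_s,\qquad s-k\ge 2,\quad 1\le k<s\le n.$$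
   Context: **Braid semigroup.** $B_{n+1}^+$ is the semigroup (with identity, the empty word) generated by $a_1,\dots,a_n$ with defining relations $a_{i+1}a_ia_{i+1}=a_ia_{i+1}a_i$ ($1\le i\le n-1$) and $a_ia_j=a_ja_i$ ($i-j\ge 2$). **Word notation.** $a_{ij}=a_ia_{i-1}\cdots a_j$ for $i\ge j$ (so $a_{ii}=a_i$), and $a_{i\,i+1}=1$ (the empty word). For $j\le i$, $W(j,i)$ (or $V(j,i)$) denotes any word, possibly empty, in the alphabet $\{a_j,a_{j+1},\dots,a_i\}$; for $j>i$ it denotes the empty word. **Order.** Deg-lex order: words are compared first by length and then lexicographically. **Gröbner-Shirshov bases.** Let $k$ be a field, $\mathbf X$ a linearly ordered set, $k\langle\mathbf X\rangle$ the free associative algebra, and fix a monomial well order on the set $\mathbf X^*$ of words. $\bar f$ denotes the leading word of a polynomial $f$; $f$ is monic if $\bar f$ has coefficient $1$. For monic $f,g$: if $w=\bar f b=a\bar g$ with $\deg\bar f+\deg\bar g>\deg w$, the composition of intersection is $(f,g)_w=fb-ag$; if $w=\bar f=a\bar g b$, the composition of including is $(f,g)_w=f-agb$. A composition $(f,g)_w$ is trivial relative to $\mathbf S\subset k\langle\mathbf X\rangle$ if $(f,g)_w=\sum\alpha_i a_it_ib_i$ with $\alpha_i\in k$, $t_i\in\mathbf S$, $a_i,b_i\in\mathbf X^*$ and $\overline{a_it_ib_i}<w$. A set $\mathbf S$ of monic polynomials is a Gröbner-Shirshov basis if every composition of elements of $\mathbf S$ is trivial relative to $\mathbf S$. A relation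 $u=v$ between words with $u>v$ is identified with the polynomial $u-v$. A Gröbner-Shirshov basis of a semigroup presented by generators $\mathbf X$ and relations $\mathbf R$ is a Gröbner-Shirshov basis $\mathbf S\subset k\langle\mathbf X\rangle$ consisting of semigroup relations and generating the same ideal of $k\langle\mathbf X\rangle$ as $\mathbf R$ (this does not depend on $k$). *)

(* Defs.v *)
From HB Require Import structures.
From mathcomp Require Import all_boot all_order all_algebra.
From mathcomp Require Import finmap monalg.

Set Implicit Arguments.
Unset Strict Implicit.
Unset Printing Implicit Defensive.

Import Order.TTheory GRing.Theory.
Import Order.DefaultSeqLexiOrder.

Local Notation "u * v" := (mmul u v) : monom_scope.

Local Open Scope ring_scope.

(* The free associative algebra k<X> is the monoid algebra                    *)
(* {malg k[{fmonom X}]} of the free monoid X^* = {fmonom X}; the coefficient  *)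
(* of the word w in f is f@_w, the support of f is msupp f, and << w >> is    *)
(* the word w seen as a polynomial.                                           *)

Record monomial_order (M : monomType) := MonomialOrder {
  mlt :> rel M;
  mlt_irr : irreflexive mlt;
  mlt_trans : transitive mlt;
  mlt_total : forall u v, [|| u == v, mlt u v | mlt v u];
  mlt_mul : forall a b u v, mlt u v -> mlt (a * u * b)%M (a * v * b)%M;
  mlt_wf : well_founded mlt
}.

Section DegLex.
Context (disp : Order.disp_t) (X : finOrderType disp).
Implicit Types u v w : {fmonom X}.

Definition deglex u v : bool :=
  (fdeg u < fdeg v)%N || (fdeg u == fdeg v) && ((u : seq X) < (v : seq X))%O.

Lemma deglex_irr : irreflexive deglex.
Proof. by move=> u; rewrite /deglex ltnn eqxx ltxx. Qed.

Lemma deglex_trans : transitive deglex.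
Proof.
move=> v u w; rewrite /deglex.
case/orP=> [lt1 | /andP[/eqP e1 l1]] /orP[lt2 | /andP[/eqP e2 l2]].
- by rewrite (ltn_trans lt1 lt2).
- by rewrite -e2 lt1.
- by rewrite e1 lt2.
- by rewrite e1 e2 eqxx (lt_trans l1 l2) orbT.
Qed.

Lemma deglex_total u v : [|| u == v, deglex u v | deglex v u].
Proof.
rewrite /deglex; case: (ltngtP (fdeg u) (fdeg v)) => //= [_|_|e].
- by rewrite orbT.
- by rewrite !orbT.
- by rewrite -(inj_eq val_inj); case: (ltgtP (u : seq X) (v : seq X)) => //= ->.
Qed.

Lemma ltxi_cat2l (s t1 t2 : seq X) : ((s ++ t1) < (s ++ t2))%O = (t1 < t2)%O.
Proof. by elim: s => //= x s IH; rewrite ltxi_cons lexx /= IH. Qed.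

Lemma ltxi_catr (s1 s2 t : seq X) : size s1 = size s2 ->
  (s1 < s2)%O -> ((s1 ++ t) < (s2 ++ t))%O.
Proof.
elim: s1 s2 => [|x1 s1 IH] [|x2 s2] //= [e].
by rewrite !ltxi_cons => /andP[-> /= /implyP l]; apply/implyP => /l; apply: IH.
Qed.

Lemma deglex_mul a b u v : deglex u v -> deglex (a * u * b)%M (a * v * b)%M.
Proof.
rewrite /deglex /fdeg !fmM !size_cat ltn_add2r ltn_add2l eqn_add2r eqn_add2l.
case/orP=> [->//|/andP[/eqP e l]]; rewrite e eqxx /= -!catA ltxi_cat2l.
by rewrite ltxi_catr ?orbT.
Qed.

Lemma deglex_wf : well_founded deglex.
Proof.
suff P m r u : (fdeg u < m)%N ->
    (#|[set t : (fdeg u).-tuple X | (val t < u :> seq X)%O]| < r)%N ->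
    Acc deglex u by move=> u; exact: (P _ _ u (ltnSn _) (ltnSn _)).
elim: m r u => [|m IHm] r u; first by rewrite ltn0.
elim: r u => [|r IHr] u lu ru; first by rewrite ltn0 in ru.
split=> v.
case/orP=> [lvu | /andP[/eqP e lvu]].
  by apply: (IHm _ v _ (ltnSn _)); apply: leq_trans lvu lu.
apply: IHr; rewrite e //; rewrite ltnS in ru; apply: leq_trans ru.
have sv : size v == fdeg u by rewrite -e.
apply: proper_card; apply/properP; split.
  by apply/subsetP => t; rewrite !inE => /lt_trans; apply.
by exists (Tuple sv); rewrite !inE /= ?ltxx.
Qed.

Definition deglex_order : monomial_order {fmonom X} :=
  MonomialOrder deglex_irr deglex_trans deglex_total deglex_mul deglex_wf.

End DegLex.

Section GroebnerShirshov.
Context (k : fieldType) (X : choiceType) (o : monomial_order {fmonom X}).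
Local Notation word := {fmonom X}.
Local Notation poly := {malg k[{fmonom X}]}.
Implicit Types (f g h : poly) (u v w : word) (S : poly -> Prop).

(* The empty word is the least one, so it can start the maximum; the leading  *)
(* word of 0 is then the empty word.                                          *)
Definition lead f : word :=
  \big[(fun u v => if o u v then v else u)/mone]_(u <- msupp f) u.

Definition monic f : Prop := f@_(lead f) = 1.

Variant composition f g : word -> poly -> Prop :=
| CompIntersection (w a b : word) of
    w = (lead f * b)%M & w = (a * lead g)%M
    & (fdeg w < fdeg (lead f) + fdeg (lead g))%N :
    composition f g w (f * << b >> - << a >> * g)
| CompIncluding (w a b : word) of w = lead f & w = (a * lead g * b)%M :
    composition f g w (f - << a >> * g * << b >>).

Definition trivial_rel S w h : Prop :=
  exists (m : nat) (alpha : 'I_m -> k) (a b : 'I_m -> word) (t : 'I_m -> poly),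
    (forall i, S (t i) /\ o (lead (<< a i >> * t i * << b i >>)) w)
    /\ h = \sum_(i < m) alpha i *: (<< a i >> * t i * << b i >>).

Definition GS_basis S : Prop :=
  (forall f, S f -> monic f) /\
  (forall f g w h, S f -> S g -> composition f g w h -> trivial_rel S w h).

(* Membership in the two-sided ideal of k<X> generated by S. *)
Definition in_ideal S f : Prop :=
  exists (m : nat) (p q t : 'I_m -> poly),
    (forall i, S (t i)) /\ f = \sum_(i < m) p i * t i * q i.

Definition relation_polys (T : word -> word -> Prop) f : Prop :=
  exists u v, T u v /\ f = << u >> - << v >>.

(* T is a Groebner-Shirshov basis of the semigroup < X | R >; each relation   *)
(* u = v of T is oriented, with u > v.                                        *)
Definition semigroup_GS_basis (R T : word -> word -> Prop) : Prop :=
  [/\ forall u v, T u v -> o v u,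
      GS_basis (relation_polys T)
    & forall f, in_ideal (relation_polys T) f <-> in_ideal (relation_polys R) f].

End GroebnerShirshov.

Local Close Scope ring_scope.

(* A word in a_1, ..., a_n is handled through the sequence of the indices of  *)
(* its letters; the generator a_k is the ordinal k - 1 of 'I_n.               *)
Definition indices (n : nat) (u : {fmonom 'I_n}) : seq nat :=
  [seq (nat_of_ord x).+1 | x <- u].

Definition on_indices (n : nat) (T : seq nat -> seq nat -> Prop)
    (u v : {fmonom 'I_n}) : Prop := T (indices u) (indices v).

Variant braid_relation (n : nat) : seq nat -> seq nat -> Prop :=
| BraidYB i of 1 <= i <= n - 1 :
    braid_relation n [:: i.+1; i; i.+1] [:: i; i.+1; i]
| BraidComm i j of 1 <= j <= n & 1 <= i <= n & j + 2 <= i :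
    braid_relation n [:: i; j] [:: j; i].

Lemma indices_inj n : injective (@indices n).
Proof.
by move=> u v /(inj_map (inj_comp succn_inj val_inj)) /val_inj.
Qed.

Lemma indices_onto n (s : seq nat) :
  all (fun l => 1 <= l <= n) s -> exists u : {fmonom 'I_n}, indices u = s.
Proof.
elim: s => [_|[//|l] s IH]; first by exists (FMonom [::]).
move=> /= /andP[ln /IH[u <-]].
by exists (FMonom (Ordinal ln :: u)).
Qed.

(* a_{ij} = a_i a_{i-1} ... a_j, which is empty for j = i + 1. *)
Definition desc (i j : nat) : seq nat := rev (iota j (i.+1 - j)).

(* s is a word in a_j, ..., a_i; for j > i it has to be empty. *)
Definition word_between (j i : nat) (s : seq nat) : bool :=
  all (fun l => j <= l <= i) s.

Variant braid_GS_relation (n : nat) : seq nat -> seq nat -> Prop :=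
| BraidGS i j V W of
    1 <= i <= n - 1 & 1 <= j <= i + 1
    & word_between 1 (i - 1) V
    & word_between j i W
    & W = [::] \/ (exists W0, W = i :: W0) :
    braid_GS_relation n
      ([:: i.+1; i] ++ V ++ W ++ desc i.+1 j)
      ([:: i; i.+1; i] ++ V ++ desc i j ++ [seq l.+1 | l <- W])
| BraidGSComm s l of 1 <= l & l < s & s <= n & l + 2 <= s :
    braid_GS_relation n [:: s; l] [:: l; s].

(* Main.v *)
Require Import Defs.
From mathcomp Require Import all_boot all_order all_algebra.
From mathcomp Require Import finmap monalg.
From mathcomp Require Import zify.
From Stdlib Require Import Setoid Morphisms Classical_Prop.

(** A composition of two oriented relations is, up to sign, a difference of
    two words, both below [w] and both congruent to [w].  If each congruence
    class contains a single irreducible word, reducing the two words leads to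
    the same irreducible word, and the reduction steps form an expression that
    makes the composition trivial ([confluent_GS_basis]).  So the relations
    form a Groebner-Shirshov basis as soon as they hold in the braid semigroup
    ([braid_GS_relation_eq]) and congruent irreducible words are equal
    ([normal_braid_eq]); no case analysis on overlaps is needed.

    Uniqueness rests on Garside's lemma [braid_lcm]: the braid semigroup is
    left cancellative, and a word divisible on the left by two generators x
    and y is divisible by xy if they commute, by xyx if they are neighbours.
    By cancellation it is enough that the first letter x of an irreducible
    word x u is the least generator dividing it ([normal_head_minimal]).
    Suppose that y < x divides x u too.  If x and y commute, y divides u; by
    induction on the length the first letter of u is at most y, so the word
    starts with a descent of two commuting letters, which is reducible.
    If x = y + 1, then y x divides u, and for the same reason u = y u' where
    x divides u'.  Read u' letter by letter.  Letters below y commute with x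
    and leave it as a divisor: they form V.  When the letter y comes, the
    divisor x grows to x y, and from then on the divisor is always some
    x (x - 1) ... j: a letter between j and y leaves it unchanged, the letter
    j - 1 lengthens it, and a smaller letter would follow a letter at least j,
    so that the two could be exchanged.  These letters form W.  Reading stops
    at the letter x, after which an irreducible word has to spell the divisor.
    Thus x u starts with the left side of one of the relations. *)

Set Implicit Arguments.
Unset Strict Implicit.
Unset Printing Implicit Defensive.

Import GRing.Theory.

(** * The braid congruence *)

Definition far i j := (i.+1 < j) || (j.+1 < i).
Definition adj i j := (i.+1 == j) || (j.+1 == i).

(** Both directions of each relation are steps, so that the congruence is the
    reflexive transitive closure.  Contexts on the right are built into the
    first two constructors: the position of a step is then given by the number
    of letters before it, which is what arguments about first letters need.
    The letters are arbitrary naturals, since a step does not introduce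
    letters that were not present. *)
Inductive braid_step : seq nat -> seq nat -> Prop :=
| StepFar i j s of far i j : braid_step (i :: j :: s) (j :: i :: s)
| StepAdj i j s of adj i j :
    braid_step (i :: j :: i :: s) (j :: i :: j :: s)
| StepCons x s t of braid_step s t : braid_step (x :: s) (x :: t).

Inductive braid_eq : seq nat -> seq nat -> Prop :=
| BraidRefl s : braid_eq s s
| BraidStep s t r of braid_step s t & braid_eq t r : braid_eq s r.

Local Notation "s =b t" := (braid_eq s t) (at level 70, no associativity).

#[local] Hint Resolve BraidRefl : core.

Lemma far_irr x : far x x = false.
Proof. by rewrite /far ltnNge leqnSn. Qed.

Lemma adj_irr x : adj x x = false.
Proof. by rewrite /adj; lia. Qed.

Lemma far_adj x y : far x y -> adj x y = false.
Proof. by rewrite /far /adj; lia. Qed.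

Lemma far_sym i j : far i j -> far j i.
Proof. by rewrite /far orbC. Qed.

Lemma adj_sym i j : adj i j -> adj j i.
Proof. by rewrite /adj orbC. Qed.

Lemma braid_step_sym s t : braid_step s t -> braid_step t s.
Proof.
elim=> [i j r|i j r|x r q _]; last exact: StepCons.
- by move=> /far_sym; apply: StepFar.
- by move=> /adj_sym; apply: StepAdj.
Qed.

Lemma braid_eq_trans : Transitive braid_eq.
Proof.
by move=> s t r st; elim: st r => // ? ? ? h _ IH r /IH; apply: BraidStep.
Qed.

Lemma braid_step_eq s t : braid_step s t -> s =b t.
Proof. by move=> st; apply: BraidStep st (BraidRefl _). Qed.

Lemma braid_eq_sym : Symmetric braid_eq.
Proof.
move=> s t; elim=> [r|r q p /braid_step_sym /braid_step_eq rq _ IH].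
  exact: BraidRefl.
exact: braid_eq_trans IH rq.
Qed.

#[local] Instance braid_eq_equiv : Equivalence braid_eq.
Proof. by split; [exact: BraidRefl|exact: braid_eq_sym|exact: braid_eq_trans]. Qed.

#[local] Instance cons_braid_eq :
  Proper (eq ==> braid_eq ==> braid_eq)%signature (@cons nat).
Proof.
move=> x _ <- s t; elim=> [r|r q p rq _ IH]; first exact: BraidRefl.
by apply: BraidStep IH; apply: StepCons.
Qed.

Lemma braid_step_cat s t r : braid_step s t -> braid_step (s ++ r) (t ++ r).
Proof.
elim=> [i j q|i j q|x p q _] /=; [exact: StepFar|exact: StepAdj|exact: StepCons].
Qed.

#[local] Instance cat_braid_eq :
  Proper (braid_eq ==> braid_eq ==> braid_eq)%signature (@cat nat).
Proof.
move=> s s' ss' t t' tt'; transitivity (s ++ t').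
  by elim: s {ss'} => //= x s ->.
elim: ss' => // p q r /(braid_step_cat t') pq _; exact: BraidStep.
Qed.

Lemma far_swap i j s : far i j -> i :: j :: s =b j :: i :: s.
Proof. by move=> ij; apply/braid_step_eq/StepFar. Qed.

Lemma adj_braid i j s : adj i j -> i :: j :: i :: s =b j :: i :: j :: s.
Proof. by move=> ij; apply/braid_step_eq/StepAdj. Qed.

Lemma braid_step_size s t : braid_step s t -> size s = size t.
Proof. by elim=> //= x ? ? _ ->. Qed.

Lemma braid_eq_size s t : s =b t -> size s = size t.
Proof. by elim=> // ? ? ? /braid_step_size -> _ ->. Qed.

(** * Least common multiples of generators *)

(** The shape of two words [s] and [t] such that [x :: s] and [y :: t] are
    congruent: both products are right multiples of the lcm of [x] and [y],
    which is x, xy or xyx. *)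
Variant lcm_cofactors x y s t : Prop :=
| LcmSame of x = y & s =b t
| LcmFar r of far x y & s =b y :: r & t =b x :: r
| LcmAdj r of adj x y & s =b y :: x :: r & t =b x :: y :: r.

Lemma lcm_cofactors_congr x y s s' t :
  s =b s' -> lcm_cofactors x y s' t -> lcm_cofactors x y s t.
Proof.
move=> es [exy st|r f es' et|r a es' et].
- by apply: LcmSame => //; apply: braid_eq_trans es st.
- by apply: (LcmFar f _ et); apply: braid_eq_trans es es'.
- by apply: (LcmAdj a _ et); apply: braid_eq_trans es es'.
Qed.

Lemma lcm_cofactors_cancel x s t : lcm_cofactors x x s t -> s =b t.
Proof. by case=> // r; rewrite ?far_irr ?adj_irr. Qed.

Lemma lcm_cofactors_far x y s t : far x y -> lcm_cofactors x y s t ->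
  exists2 r, s =b y :: r & t =b x :: r.
Proof.
move=> f [e|r _ ? ?|r]; last by rewrite far_adj.
  by rewrite e far_irr in f.
by exists r.
Qed.

Lemma lcm_cofactors_adj x y s t : adj x y -> lcm_cofactors x y s t ->
  exists2 r, s =b y :: x :: r & t =b x :: y :: r.
Proof.
move=> a [e|r /far_adj|r _ ? ?]; [|by rewrite a|by exists r].
by rewrite e adj_irr in a.
Qed.

Lemma lcm_cofactors_sym x y s t : lcm_cofactors x y s t -> lcm_cofactors y x t s.
Proof.
case=> [-> st|r /far_sym f es et|r /adj_sym f es et].
- by apply: LcmSame => //; apply: braid_eq_sym.
- exact: LcmFar et es.
- exact: LcmAdj et es.
Qed.

(** Garside's lemma for words of bounded length, as the induction hypothesis
    of its proof. *)
Definition lcm_upto n := forall x y s t,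
  size s < n -> x :: s =b y :: t -> lcm_cofactors x y s t.

(** The next lemmas compose Garside's lemma for x, z and for z, y, when the two
    share the word starting with z.  Its cofactors are shorter, so the
    induction hypothesis exhibits the lcm of x, y and z; what is left is a
    computation inside that lcm.  On a line three letters are never pairwise
    neighbours, which bounds the number of cases. *)
Lemma lcm_cofactors_far_far x z y p q r s t : lcm_upto (size r) ->
  far x z -> s =b z :: p -> r =b x :: p ->
  far z y -> r =b y :: q -> t =b z :: q -> lcm_cofactors x y s t.
Proof.
move=> IH fxz es er fzy er' et.
have : lcm_cofactors x y p q.
  by apply: IH; rewrite ?(braid_eq_size er) //= -er.
case=> [<- pq|m fxy ep eq|m axy ep eq].
- by apply: LcmSame => //; rewrite es et pq.
- apply: (LcmFar (r := z :: m)) => //.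
    by rewrite es ep far_swap.
  by rewrite et eq far_swap // far_sym.
- have fyz := far_sym fzy; have fzx := far_sym fxz.
  apply: (LcmAdj (r := z :: m)) => //.
    by rewrite es ep (far_swap _ fzy) (far_swap _ fzx).
  by rewrite et eq (far_swap _ fzx) (far_swap _ fzy).
Qed.

Lemma lcm_cofactors_far_adj x z y p q r s t : lcm_upto (size r) ->
  far x z -> s =b z :: p -> r =b x :: p ->
  adj z y -> r =b y :: z :: q -> t =b z :: y :: q -> lcm_cofactors x y s t.
Proof.
move=> IH fxz es er azy er' et; have fzx := far_sym fxz; have ayz := adj_sym azy.
have ltp : size p < size r by rewrite (braid_eq_size er).
have ltq : size q < size r by rewrite (braid_eq_size er') /=; lia.
have : lcm_cofactors x y p (z :: q) by apply: IH; rewrite // -er.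
case=> [exy|m fxy ep eq|m axy ep eq].
- by move: fxz azy; rewrite exy /far /adj; lia.
- have [l eq' em] := lcm_cofactors_far fzx (IH _ _ _ _ ltq eq).
  apply: (LcmFar (r := z :: y :: l)) => //.
    by rewrite es ep em (adj_braid _ azy).
  by rewrite et eq' -(far_swap _ fxy) (far_swap _ fxz).
- have [l eq' em] := lcm_cofactors_far fzx (IH _ _ _ _ ltq eq).
  have ltm : size m < size r.
    by have /= := braid_eq_size ep; have /= := braid_eq_size er; lia.
  have [k em' el] := lcm_cofactors_adj ayz (IH _ _ _ _ ltm em).
  have ayx := adj_sym axy.
  apply: (LcmAdj (r := z :: y :: x :: k)) => //.
    by rewrite es ep em' (far_swap (y :: k) fxz) (adj_braid _ azy) (adj_braid _ ayx)
               (far_swap _ fzx).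
  by rewrite et eq' el -(adj_braid _ axy) (far_swap _ fzx) (far_swap k fxz)
             (adj_braid _ azy).
Qed.

Lemma lcm_cofactors_adj_adj x z y p q r s t : lcm_upto (size r) ->
  adj x z -> s =b z :: x :: p -> r =b x :: z :: p ->
  adj z y -> r =b y :: z :: q -> t =b z :: y :: q -> lcm_cofactors x y s t.
Proof.
move=> IH axz es er azy er' et; have azx := adj_sym axz; have ayz := adj_sym azy.
have ltzp : (size p).+1 < size r by rewrite (braid_eq_size er).
have ltp : size p < size r by lia.
have ltq : size q < size r by rewrite (braid_eq_size er') /=; lia.
have : lcm_cofactors x y (z :: p) (z :: q) by apply: IH; rewrite // -er.
case=> [exy pq|m fxy ep eq|m axy]; last first.
- by move: axz azy axy; rewrite /adj; lia.
- have [l ep' em] := lcm_cofactors_adj azy (IH _ _ _ _ ltp ep).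
  have [k eq' em'] := lcm_cofactors_adj azx (IH _ _ _ _ ltq eq).
  have eyx : z :: y :: l =b z :: x :: k by rewrite -em.
  have ltyl : size (y :: l) < size r by have /= := braid_eq_size ep'; lia.
  have {}eyx := lcm_cofactors_cancel (IH _ _ _ _ ltyl eyx).
  have ltl' : size l < size r by have /= := braid_eq_size ep'; lia.
  have [j el ek] := lcm_cofactors_far (far_sym fxy) (IH _ _ _ _ ltl' eyx).
  have fyx := far_sym fxy.
  apply: (LcmFar (r := z :: y :: x :: z :: j)) => //.
    by rewrite es ep' el (far_swap _ fxy) (adj_braid _ axz) (adj_braid _ azy).
  by rewrite et eq' ek (far_swap _ fyx) (adj_braid _ ayz) (adj_braid _ azx)
             (far_swap _ fxy).
- apply: LcmSame => //; rewrite es et -exy.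
  by rewrite (lcm_cofactors_cancel (IH _ _ _ _ ltp pq)).
Qed.

Lemma lcm_cofactors_trans x z y s r t : lcm_upto (size r) ->
  lcm_cofactors x z s r -> lcm_cofactors z y r t -> lcm_cofactors x y s t.
Proof.
move=> IH; case=> [-> sr|p fxz es er|p axz es er].
- exact: lcm_cofactors_congr.
- case=> [<- rt|q fzy er' et|q azy er' et].
  + by apply: (LcmFar (r := p)) => //; rewrite -rt.
  + exact: lcm_cofactors_far_far er fzy er' et.
  + exact: lcm_cofactors_far_adj er azy er' et.
- case=> [<- rt|q fzy er' et|q azy er' et].
  + by apply: (LcmAdj (r := p)) => //; rewrite -rt.
  + apply/lcm_cofactors_sym/(lcm_cofactors_far_adj IH (far_sym fzy)); eauto.
    exact: adj_sym.
  + exact: lcm_cofactors_adj_adj er azy er' et.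
Qed.

Lemma lcm_cofactors_step x y s t :
  braid_step (x :: s) (y :: t) -> lcm_cofactors x y s t.
Proof.
move=> st; inversion st; subst.
- exact: (LcmFar (r := s0)).
- exact: (LcmAdj (r := s0)).
- by apply: LcmSame => //; apply: braid_step_eq.
Qed.

(** Garside's lemma, by induction on the length and then on the number of
    steps: the word z r after the first step splits the chain, and
    [lcm_cofactors_trans] glues the two parts. *)
Lemma braid_lcm x y s t : x :: s =b y :: t -> lcm_cofactors x y s t.
Proof.
have [n] := ubnP (size s); elim: n x y s t => // n IH x y s t.
rewrite ltnS => le_sn.
move es: (x :: s) => s'; move et: (y :: t) => t' st.
elim: st x s es le_sn et => [r|s1 r' t1 sr _ IHrt] x s es le_sn et.
  by move: es; rewrite -et => -[-> ->]; apply: LcmSame.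
rewrite -es in sr; case: r' sr IHrt => [/braid_step_size //|z r] sr IHrt.
have sz_r : size s = size r by case: (braid_step_size sr).
have le_rn : size r <= n by rewrite -sz_r.
apply: lcm_cofactors_trans (IHrt _ _ erefl le_rn et).
  by move=> x1 y1 s2 t2 lt_r; apply: IH; apply: leq_trans le_rn.
exact: lcm_cofactors_step.
Qed.

Lemma braid_cancel x s t : x :: s =b x :: t -> s =b t.
Proof. by move=> /braid_lcm/lcm_cofactors_cancel. Qed.

Lemma desc_nil i j : i < j -> desc i j = [::].
Proof. by move=> lt; rewrite /desc; have -> : i.+1 - j = 0 by lia. Qed.

Lemma descS i j : j <= i.+1 -> desc i.+1 j = i.+1 :: desc i j.
Proof.
move=> le; rewrite /desc subSn // -addn1 iotaD rev_cat /=.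
by congr (_ :: _); lia.
Qed.

(** * Divisibility by descending words *)

Definition left_divides p u := exists w, u =b p ++ w.

Lemma left_divides_cons x p u : left_divides (x :: p) (x :: u) -> left_divides p u.
Proof. by case=> w /braid_cancel uw; exists w. Qed.

(** The lcm of [m] and a word in letters that commute with it is their
    product. *)
Lemma left_divides_desc_far m l j u :
  0 < j -> l.+1 < m -> left_divides (desc l j) (m :: u) -> left_divides (desc l j) u.
Proof.
move=> j0; elim: l u => [|l IH] u lm; first by rewrite desc_nil //; exists u.
have [le|lt] := leqP j l.+1; last by rewrite desc_nil //; exists u.
rewrite descS // => -[w mu].
have f : far m l.+1 by rewrite /far lm orbT.
have [r ur lr] := lcm_cofactors_far f (braid_lcm mu).
have [r' rr'] : left_divides (desc l j) r by apply: IH; [lia|exists w; rewrite -lr].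
by exists r'; rewrite ur rr'.
Qed.

(** As z (m ... j) = (m ... j) (z + 1), both [z] and [desc m j] divide this
    word; it is their lcm, so what divides [z :: u] divides [u]. *)
Lemma left_divides_desc m j z u :
    0 < j -> j <= z -> z < m -> left_divides (desc m j) (z :: u) ->
  left_divides (desc m j) u.
Proof.
move=> j0 jz; elim: m u => // m IH u zm; rewrite descS; last by lia.
case=> w zu; have [lt|ge] := ltnP z m.
  have f : far z m.+1 by rewrite /far; lia.
  have [r ur mr] := lcm_cofactors_far f (braid_lcm zu).
  have [r' rr'] : left_divides (desc m j) r by apply: IH => //; exists w; rewrite -mr.
  by exists r'; rewrite ur rr'.
have {ge zm} e : z = m by lia.
case: z e jz zu {IH} => [|z] e jz zu; first by lia.
have a : adj z.+1 m.+1 by rewrite -e /adj eqxx.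
have [r ur mr] := lcm_cofactors_adj a (braid_lcm zu).
rewrite -e in ur mr zu *; rewrite descS // in mr zu *; move/braid_cancel: mr => mr.
have [r' rr'] : left_divides (desc z j) r.
  by apply: (left_divides_desc_far (m := z.+2)) => //; exists w; rewrite -mr.
by exists r'; rewrite ur rr'.
Qed.

(** Here the divisor gains a letter: z and m (m - 1) ... (z + 1) have the lcm
    z m (m - 1) ... z. *)
Lemma left_divides_desc_extend m z u :
    0 < z -> z < m -> left_divides (desc m z.+1) (z :: u) ->
  left_divides (desc m z) u.
Proof.
move=> z0; elim: m u => // m IH u zm; rewrite !descS; try lia.
case=> w zu; have [lt|ge] := ltnP z m.
  have f : far z m.+1 by rewrite /far; lia.
  have [r ur mr] := lcm_cofactors_far f (braid_lcm zu).
  have [r' rr'] : left_divides (desc m z) r by apply: IH => //; exists w; rewrite -mr.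
  by exists r'; rewrite ur rr'.
have {ge zm} e : z = m by lia.
have a : adj z m.+1 by rewrite -e /adj eqxx.
have [r ur _] := lcm_cofactors_adj a (braid_lcm zu).
exists r; rewrite ur -e; case: z z0 {IH e a zu ur} => // z _.
by rewrite descS // desc_nil.
Qed.

(** * Uniqueness of irreducible words *)

Section NormalWords.
Variable n : nat.

Definition reducible u :=
  exists a l r b, braid_GS_relation n l r /\ u = a ++ l ++ b.

Lemma reducible_cons x u : reducible u -> reducible (x :: u).
Proof. by case=> a [l [r [b [lr ->]]]]; exists (x :: a), l, r, b. Qed.

Lemma reducible_prefix l r b : braid_GS_relation n l r -> reducible (l ++ b).
Proof. by exists [::], l, r, b. Qed.

Definition normal u := word_between 1 n u /\ ~ reducible u.

Lemma normal_cons x u : normal (x :: u) -> normal u.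
Proof.
by case=> /= /andP[_ un] irr; split=> // /(reducible_cons x).
Qed.

Lemma normal_descent x y u : normal [:: x, y & u] -> x <= y.+1.
Proof.
case=> /= /and3P[/andP[x1 xn] /andP[y1 yn] _] irr.
rewrite leqNgt; apply/negP => lt; apply: irr.
by apply: (@reducible_prefix [:: x; y] [:: y; x] u); apply: BraidGSComm; lia.
Qed.

(** The first letter of a short normal word is its least divisor: the
    induction hypothesis of [normal_head_minimal]. *)
Definition head_minimal_upto N := forall x u y v,
  size u < N -> normal (x :: u) -> x :: u =b y :: v -> x <= y.

Section Bounded.
Variable N : nat.
Hypothesis hmin : head_minimal_upto N.

Lemma left_divides_head x p u : left_divides (x :: p) u -> normal u ->
  size u <= N -> exists z v, [/\ u = z :: v, z <= x & size v < N].
Proof.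
case: u => [|z v] [w uw] nu le; first by have := braid_eq_size uw.
by exists z, v; split=> //; apply: (hmin _ nu uw).
Qed.

(** Each letter of the word is at most the next letter of the divisor by
    minimality, and at least it because a normal word descends by one at most;
    so the word spells the divisor. *)
Lemma normal_desc_prefix m j u :
    0 < j -> j <= m -> size u < N -> normal (m :: u) ->
  left_divides (desc m j) (m :: u) -> exists t, m :: u = desc m j ++ t.
Proof.
move=> j0; elim: m u => [|m IH] u jm uN nu; first by lia.
rewrite descS // => /left_divides_cons du.
have [jm'|lt] := leqP j m; last by rewrite desc_nil //; exists u.
case: m => [|m] in IH jm nu du jm' *; first by lia.
rewrite descS // in du.
have [|z [v [eu zm vN]]] := left_divides_head du (normal_cons nu); first by lia.
rewrite eu in nu uN du *.
have ez : z = m.+1 by have := normal_descent nu; lia.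
rewrite ez in nu du *.
have [|||t ->] := IH v _ vN; last by exists t.
- by [].
- exact: normal_cons nu.
- by rewrite descS.
Qed.

(** The letter [p] stands for the last letter read.  It keeps the next letter
    from falling below [j - 1], so that the divisor can only stay or grow by
    one letter until [i.+1] is reached. *)
Lemma normal_left_divides_desc i j p v :
    0 < j -> j <= p <= i -> size v <= N -> normal (p :: v) ->
    left_divides (desc i.+1 j) v ->
  exists W j' t, [/\ v = W ++ desc i.+1 j' ++ t, 0 < j', j' <= j
                   & word_between j' i W].
Proof.
elim: v p j => [|z v IH] p j j0 /andP[jp pi] vN nv dv.
  by case: dv => w /braid_eq_size; rewrite descS //; lia.
have jSi : j <= i.+1 by lia.
have nzv := normal_cons nv.
have zSi : z <= i.+1.
  have dv' := dv; rewrite descS // in dv'.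
  by have [_ [_ [[<- _] ? _]]] := left_divides_head dv' nzv vN.
have [ez|nez] := eqVneq z i.+1.
  rewrite ez in dv nzv *.
  have [t ->] := normal_desc_prefix j0 jSi vN nzv dv.
  by exists [::], j, t.
have zi : z <= i by lia.
have pz := normal_descent nv.
have z0 : 0 < z by case: nzv => /= /andP[/andP[]].
have [jz|zj] := leqP j z.
  have [||||W [j' [t [-> j'0 j'j wW]]]] := IH z j j0.
  - by rewrite jz.
  - by rewrite ltnW.
  - exact: nzv.
  - exact: (left_divides_desc j0 jz).
  by exists (z :: W), j', t; split=> //; rewrite /= zi (leq_trans j'j jz).
have ej : j = z.+1 by lia.
have [||||W [j' [t [-> j'0 j'z wW]]]] := IH z z z0.
- by rewrite leqnn.
- by rewrite ltnW.
- exact: nzv.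
- by apply: left_divides_desc_extend; rewrite -?ej.
exists (z :: W), j', t; split=> //; first by lia.
by rewrite /= zi j'z.
Qed.

(** A normal word divisible by [i.+1] starts with V W a_(i+1) ... a_j, which
    is what follows a_(i+1) a_i on the left side of a relation. *)
Lemma normal_left_divides_gen i u :
    size u <= N -> normal u -> left_divides [:: i.+1] u ->
  exists V W j t, [/\ u = V ++ W ++ desc i.+1 j ++ t, 1 <= j <= i + 1,
    word_between 1 (i - 1) V, word_between j i W
    & W = [::] \/ exists W0, W = i :: W0].
Proof.
elim: u => [|z u IH] uN nu du; first by case: du => w /braid_eq_size.
have [_ [_ [[<- _] zSi _]]] := left_divides_head du nu uN.
have nu' := normal_cons nu; have uN' : size u <= N by apply: ltnW.
have z0 : 0 < z by case: nu => /= /andP[/andP[]].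
have [ez|nez] := eqVneq z i.+1.
  exists [::], [::], i.+1, u; split=> //; last by left.
  - by rewrite descS // desc_nil // ez.
  - by rewrite addn1 leqnn.
case: du => w zu; have [zi|zi] := ltnP z i.
  have f : far z i.+1 by rewrite /far; lia.
  have [r ur _] := lcm_cofactors_far f (braid_lcm zu).
  have [|V [W [j [t [-> hj wV wW hW]]]]] := IH uN' nu'; first by exists r.
  exists (z :: V), W, j, t; split=> //=.
  by rewrite wV z0 andbT; lia.
have {}zi : z = i by lia.
have a : adj z i.+1 by rewrite /adj zi eqxx.
have [r ur _] := lcm_cofactors_adj a (braid_lcm zu).
have [||W [j [t [-> j0 jz wW]]]] := normal_left_divides_desc z0 _ uN' nu (i := i).
- by rewrite zi leqnn.
- by exists r; rewrite zi; case: i z0 zi {IH zu a nez zSi} ur => [|i] z0 zi ur;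
     [lia | rewrite ur zi !descS // desc_nil].
exists [::], (z :: W), j, t; split=> //.
- by rewrite j0; lia.
- by rewrite /= zi wW -zi jz leqnn.
- by right; exists W; rewrite zi.
Qed.

End Bounded.

(** A smaller divisor y of x u forces x u to start with the left side of a
    relation: a commutation if x and y are far apart or u starts below y, and
    one of the long relations otherwise. *)
Lemma normal_head_minimal x u y v :
  normal (x :: u) -> x :: u =b y :: v -> x <= y.
Proof.
have [N] := ubnP (size u); elim: N x u y v => // N IH x u y v.
rewrite ltnS => uN nxu xuyv; rewrite leqNgt; apply/negP => yx.
have hmin : head_minimal_upto N by exact: IH.
have nu := normal_cons nxu.
have head w : u =b y :: w -> exists2 u', u = y :: u' & y.+1 = x.
  move=> uw; have du : left_divides [:: y] u by exists w.
  have [z [u' [eu zy _]]] := left_divides_head hmin du nu uN.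
  have := nxu; rewrite eu => /normal_descent xz.
  by exists u'; [congr (_ :: _); lia | lia].
case: (braid_lcm xuyv) => [|r f ur _|r a ur _]; first by lia.
  by have [_ _ exy] := head _ ur; move: f; rewrite /far -exy; lia.
have [u' eu exy] := head _ ur.
rewrite eu in uN nu nxu ur; move/braid_cancel: ur => ur.
have dx : left_divides [:: y.+1] u' by exists r; rewrite ur exy.
have [|V [W [j [t [eu' hj wV wW hW]]]]] :=
  normal_left_divides_gen hmin _ (normal_cons nu) dx; first exact: ltnW.
case: nxu => /= /and3P[/andP[_ xn] /andP[y0 _] _]; apply.
have hy : 1 <= y <= n - 1 by lia.
have := reducible_prefix t (BraidGS hy hj wV wW hW).
by rewrite eu' -exy -!catA.
Qed.

Lemma normal_braid_eq u v : normal u -> normal v -> u =b v -> u = v.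
Proof.
elim: u v => [|x u IH] [|y v] nu nv uv //; try by have := braid_eq_size uv.
have exy : x = y.
  by apply/eqP; rewrite eqn_leq (normal_head_minimal nu uv)
                        (normal_head_minimal nv (braid_eq_sym uv)).
rewrite -exy in nv uv *; congr (_ :: _).
exact: IH (normal_cons nu) (normal_cons nv) (braid_cancel uv).
Qed.

(** * The relations hold in the braid semigroup *)

Lemma braid_eq_far_head V m s :
  word_between 1 (m - 2) V -> V ++ m :: s =b m :: V ++ s.
Proof.
elim: V => //= z V IH /andP[/andP[z0 zm] /IH ->].
by apply: far_swap; rewrite /far; lia.
Qed.

Lemma desc_far m l j s :
  l.+1 < m -> 0 < j -> m :: desc l j ++ s =b desc l j ++ m :: s.
Proof.
move=> + j0; elim: l => [|l IH] lm; first by rewrite desc_nil.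
have [le|lt] := leqP j l.+1; last by rewrite desc_nil.
rewrite descS //= -IH; last by lia.
by apply: far_swap; rewrite /far lm orbT.
Qed.

(** Moving a letter through a descending word raises it by one: this is where
    W' comes from. *)
Lemma desc_shift1 m j z s :
  0 < j -> j <= z -> z < m -> z :: desc m j ++ s =b desc m j ++ z.+1 :: s.
Proof.
move=> j0 jz; elim: m => // m IH zm; rewrite descS /=; last by lia.
have [lt|ge] := ltnP z m.
  by rewrite -IH // far_swap // /far; lia.
have {zm ge} -> : m = z by lia.
case: z jz {IH} => [|z] jz; first by lia.
rewrite descS //= -(desc_far s (ltnSn z.+1) j0); apply: adj_braid.
by rewrite /adj eqxx.
Qed.

Lemma desc_shift m j W :
  0 < j -> word_between j m.-1 W ->
  W ++ desc m j =b desc m j ++ [seq l.+1 | l <- W].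
Proof.
move=> j0; elim: W => [_|z W IH /= /andP[/andP[jz zm] /IH ->]].
  by rewrite cats0.
by apply: desc_shift1 => //; lia.
Qed.

Lemma braid_GS_relation_eq l r : braid_GS_relation n l r -> l =b r.
Proof.
case=> {l r} [i j V W /andP[i0 _] /andP[j0 ji] wV wW _|s l _ _ _ ls]; last first.
  by apply: far_swap; rewrite /far; lia.
have wV' : word_between 1 (i.+1 - 2) V by have -> : i.+1 - 2 = i - 1 by lia.
rewrite /= (desc_shift (m := i.+1) j0 wW) descS; last by lia.
rewrite cat_cons (braid_eq_far_head _ wV').
by apply: adj_braid; rewrite /adj eqxx orbT.
Qed.

End NormalWords.

(** * Binomial relations in the free algebra *)

Lemma subrB_common (V : zmodType) (x y z : V) : (x - y - (x - z) = z - y)%R.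
Proof. by rewrite opprB addrC addrA subrK. Qed.

Lemma mulr_sandwich (R : pzRingType) (g p t q h : R) :
  (g * (p * t * q) * h = g * p * t * (q * h))%R.
Proof. by rewrite !mulrA. Qed.

Section BinomialBases.
Local Open Scope ring_scope.
Context (k : fieldType) (X : choiceType) (o : monomial_order {fmonom X}).
Local Notation word := {fmonom X}.
Local Notation poly := {malg k[{fmonom X}]}.
Implicit Types (f g h : poly) (u v w a b p q : word) (S : poly -> Prop)
  (T : word -> word -> Prop).

Lemma mlt_mull a u v : o u v -> o (mmul a u) (mmul a v).
Proof. by move=> /(mlt_mul a mone); rewrite !mulm1. Qed.

Lemma mlt_mulr b u v : o u v -> o (mmul u b) (mmul v b).
Proof. by move=> /(mlt_mul mone b); rewrite !mul1m. Qed.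

(** A word u below the empty word would give the infinite descent
    u > u^2 > u^4 > ... *)
Lemma mlt_one u : o u mone = false.
Proof.
apply/negP; elim: (mlt_wf o u) => {}u _ IH lt1.
have lt2 : o (mmul u u) u by have := mlt_mull u lt1; rewrite mulm1.
exact: IH lt2 (mlt_trans lt2 lt1).
Qed.

Lemma lead_max f u : f@_u != 0 ->
  (forall v, f@_v != 0 -> v = u \/ o v u) -> lead o f = u.
Proof.
rewrite mcoeff_neq0 => uf maxu; rewrite /lead unlock.
have {}maxu v : v \in msupp f -> v = u \/ o v u by rewrite -mcoeff_neq0; apply: maxu.
(* The support is generalized to a list; where u does not occur in it, the
   running maximum only has to stay below u for u to win afterwards. *)
suff: forall s : seq word, {subset s <= msupp f} ->
    let m := reducebig mone s (fun v => BigBody v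
      (fun p q => if o p q then q else p) true v) in
    if u \in s then m = u else o u m = false.
  by move=> /(_ (msupp f) (fun _ => id)) /=; rewrite uf.
elim=> [_|v s IH sf] /=; first exact: mlt_one.
have {}IH := IH (fun x xs => sf x (mem_behead (s := v :: s) xs)).
have [->|ouv] := maxu v (sf v (mem_head v s)).
  rewrite mem_head; case: (u \in s) IH => [->|->] //; by case: ifP.
have vu : (u == v) = false by apply/eqP => e; rewrite e mlt_irr in ouv.
rewrite in_cons vu /=; case: (u \in s) IH => [->|om]; first by rewrite ouv.
case: ifP => // _; apply/negP => /mlt_trans/(_ ouv); by rewrite mlt_irr.
Qed.

Lemma mcoeff_binomial u v w :
  (<< u >> - << v >> : poly)@_w = (u == w)%:R - (v == w)%:R.
Proof. by rewrite mcoeffB !mcoeffU1. Qed.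

Lemma lead_binomial u v : o v u -> lead o (<< u >> - << v >> : poly) = u.
Proof.
move=> vu; have nvu : (v == u) = false.
  by apply/eqP => e; rewrite e mlt_irr in vu.
apply: lead_max => [|w].
  by rewrite mcoeff_binomial eqxx nvu subr0 oner_eq0.
rewrite mcoeff_binomial; case: (eqVneq u w) => [->|_]; first by left.
by case: (eqVneq v w) => [<-|_]; [right|rewrite subrr eqxx].
Qed.

Lemma mul_words u v : << u >> * << v >> = << mmul u v >> :> poly.
Proof. by rewrite malgM_def fgmulUU (mulr1 (1 : k)). Qed.

Lemma mul_binomial_l a u v : << a >> * (<< u >> - << v >>) =
  << mmul a u >> - << mmul a v >> :> poly.
Proof. by rewrite mulrBr !mul_words. Qed.

Lemma mul_binomial_r u v b : (<< u >> - << v >>) * << b >> =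
  << mmul u b >> - << mmul v b >> :> poly.
Proof. by rewrite mulrBl !mul_words. Qed.

Lemma mul_binomial a u v b : << a >> * (<< u >> - << v >>) * << b >> =
  << mmul (mmul a u) b >> - << mmul (mmul a v) b >> :> poly.
Proof. by rewrite mul_binomial_l mul_binomial_r. Qed.

Lemma trivial_rel0 S w : trivial_rel o S w 0.
Proof.
exists 0, (fun _ => 0), (fun _ => mone), (fun _ => mone), (fun _ => 0).
by split; [case|rewrite big_ord0].
Qed.

Lemma trivial_rel_gen S w c a b f : S f ->
  o (lead o (<< a >> * f * << b >>)) w ->
  trivial_rel o S w (c *: (<< a >> * f * << b >>)).
Proof.
move=> Sf lt; exists 1, (fun _ => c), (fun _ => a), (fun _ => b), (fun _ => f).
by split=> //; rewrite big_ord1.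
Qed.

Definition ord_cat A m1 m2 (f1 : 'I_m1 -> A) (f2 : 'I_m2 -> A)
    (i : 'I_(m1 + m2)) : A :=
  match split i with inl i1 => f1 i1 | inr i2 => f2 i2 end.

Lemma ord_cat_lshift A m1 m2 (f1 : 'I_m1 -> A) (f2 : 'I_m2 -> A) i :
  ord_cat f1 f2 (lshift m2 i) = f1 i.
Proof. by rewrite /ord_cat (unsplitK (inl i)). Qed.

Lemma ord_cat_rshift A m1 m2 (f1 : 'I_m1 -> A) (f2 : 'I_m2 -> A) i :
  ord_cat f1 f2 (rshift m1 i) = f2 i.
Proof. by rewrite /ord_cat (unsplitK (inr i)). Qed.

Lemma trivial_relD S w f g :
  trivial_rel o S w f -> trivial_rel o S w g -> trivial_rel o S w (f + g).
Proof.
move=> [m1 [c1 [a1 [b1 [t1 [h1 ->]]]]]] [m2 [c2 [a2 [b2 [t2 [h2 ->]]]]]].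
exists (m1 + m2)%N, (ord_cat c1 c2), (ord_cat a1 a2), (ord_cat b1 b2),
  (ord_cat t1 t2).
split.
  by move=> i; rewrite /ord_cat; case: (split i) => j; [apply: h1|apply: h2].
rewrite big_split_ord /=.
apply: (f_equal2 +%R); apply: eq_bigr => i _.
  by rewrite !ord_cat_lshift.
by rewrite !ord_cat_rshift.
Qed.

Lemma trivial_relN S w f : trivial_rel o S w f -> trivial_rel o S w (- f).
Proof.
move=> [m [c [a [b [t [h ->]]]]]].
exists m, (fun i => - c i), a, b, t; split=> //.
by rewrite -sumrN; apply: eq_bigr => i _; rewrite scaleNr.
Qed.

(** * Unique irreducible words give a Groebner-Shirshov basis *)

Section Confluence.
Context (T : word -> word -> Prop) (E : word -> word -> Prop).
Local Notation ST := (@relation_polys k _ T).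

Definition irreducible w :=
  ~ exists a u v b, T u v /\ w = mmul (mmul a u) b.

Hypothesis T_oriented : forall u v, T u v -> o v u.
Hypothesis E_equiv : RelationClasses.Equivalence E.
Hypothesis E_T : forall a u v b, T u v -> E (mmul (mmul a u) b) (mmul (mmul a v) b).
Hypothesis E_irreducible : forall p q,
  irreducible p -> irreducible q -> E p q -> p = q.

Lemma trivial_rel_step a u v b w : T u v -> o (mmul (mmul a u) b) w ->
  trivial_rel o ST w (<< mmul (mmul a u) b >> - << mmul (mmul a v) b >>).
Proof.
move=> Tuv lt; rewrite -mul_binomial -[X in trivial_rel _ _ _ X]scale1r.
apply: trivial_rel_gen; first by exists u, v.
by rewrite mul_binomial lead_binomial //; apply/mlt_mul/T_oriented.
Qed.

(** The words met while reducing [p] are at most [p], so that the sum of the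
    steps is trivial relative to every [w] above [p]. *)
Lemma irreducible_reduct p : exists q, [/\ irreducible q, E p q &
  forall w, o p w -> trivial_rel o ST w (<< p >> - << q >>)].
Proof.
elim: (mlt_wf o p) => {}p _ IH.
have [ip|/NNPP[a [u [v [b [Tuv ep]]]]]] := classic (irreducible p).
  by exists p; split=> // [|w _]; [reflexivity|rewrite subrr; apply: trivial_rel0].
set p' := mmul (mmul a v) b.
have lt : o p' p by rewrite ep; apply/mlt_mul/T_oriented.
have [q [iq Eq hq]] := IH p' lt.
exists q; split=> // [|w pw].
  by transitivity p' => //; rewrite ep; apply: E_T.
rewrite -(subrK << p' >> << p >>) -addrA; apply: trivial_relD.
  by rewrite ep; apply: trivial_rel_step => //; rewrite -ep.
exact: hq (mlt_trans lt pw).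
Qed.

Lemma trivial_rel_equiv p q w : E p q -> o p w -> o q w ->
  trivial_rel o ST w (<< p >> - << q >>).
Proof.
move=> Epq pw qw.
have [p' [ip Ep hp]] := irreducible_reduct p.
have [q' [iq Eq hq]] := irreducible_reduct q.
have epq : p' = q'.
  by apply: E_irreducible => //; transitivity p; [symmetry|transitivity q].
rewrite -(subrKA << p' >>); apply: trivial_relD; first exact: hp.
by rewrite -opprB; apply: trivial_relN; rewrite epq; apply: hq.
Qed.

(** In both kinds of composition the word [w] cancels, and what remains is the
    difference of the two words obtained from [w] by one reduction each. *)
Lemma confluent_GS_basis : GS_basis o ST.
Proof.
split=> [f [u [v [Tuv ->]]]|f g w h [u [v [Tuv ef]]] [u' [v' [Tuv' eg]]]].
  have vu := T_oriented Tuv.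
  rewrite /Defs.monic lead_binomial // mcoeff_binomial eqxx.
  by case: eqVneq vu => [->|]; [rewrite mlt_irr|rewrite subr0].
have vu := T_oriented Tuv; have vu' := T_oriented Tuv'.
have E1 a b := E_T a b Tuv; have E2 a b := E_T a b Tuv'.
have lf : lead o f = u by rewrite ef lead_binomial.
have lg : lead o g = u' by rewrite eg lead_binomial.
case=> {w h} w a b; rewrite lf lg => ew ew'.
- move=> _; rewrite ef eg mul_binomial_r mul_binomial_l -ew -ew' subrB_common.
  apply: trivial_rel_equiv.
  + transitivity w.
      by rewrite ew'; have := E2 a mone; rewrite !mulm1; symmetry.
    by rewrite ew; have := E1 mone b; rewrite !mul1m.
  + by rewrite ew'; apply: mlt_mull.
  + by rewrite ew; apply: mlt_mulr.
- rewrite ef eg mul_binomial -ew' -ew subrB_common.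
  apply: trivial_rel_equiv.
  + transitivity w; first by rewrite ew'; symmetry; apply: E2.
    by rewrite ew; have := E1 mone mone; rewrite !mul1m !mulm1.
  + by rewrite ew'; apply: mlt_mul.
  + by rewrite ew.
Qed.

End Confluence.

(** * Ideals generated by binomials *)

Lemma in_ideal0 S : in_ideal S 0.
Proof.
exists 0, (fun _ => 0), (fun _ => 0), (fun _ => 0).
by split; [case|rewrite big_ord0].
Qed.

Lemma in_ideal_mul S g h f : in_ideal S f -> in_ideal S (g * f * h).
Proof.
move=> [m [p [q [t [St ->]]]]].
exists m, (fun i => g * p i), (fun i => q i * h), t; split=> //.
rewrite mulr_sumr mulr_suml; apply: eq_bigr => i _.
exact: mulr_sandwich.
Qed.

Lemma in_ideal_gen S f : S f -> in_ideal S f.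
Proof.
exists 1, (fun _ => 1), (fun _ => 1), (fun _ => f).
by split=> //; rewrite big_ord1 mulr1 mul1r.
Qed.

Lemma in_idealN S f : in_ideal S f -> in_ideal S (- f).
Proof. by move=> /(in_ideal_mul (-1) 1); rewrite mulN1r mulr1. Qed.

Lemma in_idealD S f g : in_ideal S f -> in_ideal S g -> in_ideal S (f + g).
Proof.
move=> [m1 [p1 [q1 [t1 [h1 ->]]]]] [m2 [p2 [q2 [t2 [h2 ->]]]]].
exists (m1 + m2)%N, (ord_cat p1 p2), (ord_cat q1 q2), (ord_cat t1 t2); split.
  by move=> i; rewrite /ord_cat; case: (split i).
rewrite big_split_ord /=.
apply: (f_equal2 +%R); apply: eq_bigr => i _.
  by rewrite !ord_cat_lshift.
by rewrite !ord_cat_rshift.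
Qed.

Lemma in_ideal_trans S S' f :
  (forall t, S t -> in_ideal S' t) -> in_ideal S f -> in_ideal S' f.
Proof.
move=> SS' [m [p [q [t [St ->]]]]].
elim/big_ind: _ => [|g h|i _]; [exact: in_ideal0|exact: in_idealD|].
exact/in_ideal_mul/SS'.
Qed.

Lemma in_ideal_factor T a u v b : T u v ->
  in_ideal (@relation_polys k _ T) (<< mmul (mmul a u) b >> - << mmul (mmul a v) b >>).
Proof.
move=> Tuv; rewrite -mul_binomial; apply/in_ideal_mul/in_ideal_gen.
by exists u, v.
Qed.

End BinomialBases.

(** * Words in the generators *)

Section BraidWords.
Variable n : nat.
Local Notation word := {fmonom 'I_n}.
Implicit Types (u v w a b : word).

Lemma indicesM u v : indices (mmul u v) = indices u ++ indices v.
Proof. by rewrite /indices fmM map_cat. Qed.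

Lemma word_between_indices u : word_between 1 n (indices u).
Proof. by apply/allP => l /mapP[x _ ->] /=. Qed.

Lemma braid_step_between m s t :
  braid_step s t -> word_between 1 m s -> word_between 1 m t.
Proof.
elim=> [i j r _|i j r _|x r q _ IH] /=.
- by case/and3P=> -> -> ->.
- by case/and4P=> -> -> _ ->.
- by case/andP=> -> /IH.
Qed.

Lemma braid_eq_between m s t :
  braid_eq s t -> word_between 1 m s -> word_between 1 m t.
Proof. by elim=> // p q r /braid_step_between h _ IH /h. Qed.

Lemma indices_cat u s t : indices u = s ++ t ->
  exists a b, [/\ u = mmul a b, indices a = s & indices b = t].
Proof.
move=> e; have := word_between_indices u; rewrite e /word_between all_cat.
case/andP=> /indices_onto[a ea] /indices_onto[b eb].
by exists a, b; split=> //; apply: indices_inj; rewrite indicesM ea eb.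
Qed.

(** The right side of a relation must be a word in a_1, ..., a_n as well; this
    follows from the left side, because the two are congruent. *)
Lemma irreducible_normal u :
  irreducible (on_indices (braid_GS_relation n)) u -> normal n (indices u).
Proof.
move=> irr; split; first exact: word_between_indices.
case=> s [l [r [t [lr e]]]]; apply: irr.
have [a [ub [-> ea eub]]] := indices_cat e.
have [ul [b [-> eul eb]]] := indices_cat eub.
have [v ev] : exists v, indices v = r.
  apply/indices_onto/(braid_eq_between (braid_GS_relation_eq lr)).
  by rewrite -eul; apply: word_between_indices.
by exists a, ul, v, b; rewrite /on_indices eul ev mulmA.
Qed.

Lemma braid_GS_relation_head l r : braid_GS_relation n l r ->
  exists x y l' r', [/\ l = x :: l', r = y :: r' & y < x].
Proof.
by case=> [i j V W *|s q _ qs *]; do 4!eexists; split; try reflexivity.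
Qed.

Lemma braid_GS_oriented u v :
  on_indices (braid_GS_relation n) u v -> deglex v u.
Proof.
rewrite /on_indices /deglex !fdegE => lr; apply/orP; right.
have := braid_eq_size (braid_GS_relation_eq lr); rewrite !size_map => ->.
rewrite eqxx /=; have [x [y [l [r []]]]] := braid_GS_relation_head lr.
rewrite /indices; case: (u : seq _) => [|x' u'] //= [<- _].
case: (v : seq _) => [|y' v'] //= [<- _] lt.
have {}lt : y' < x' by [].
by rewrite ltxi_cons !leEord ltnW //= leqNgt lt.
Qed.

Section Ideal.
Local Open Scope ring_scope.
Variable k : fieldType.
Local Notation braid_ideal :=
  (in_ideal (@relation_polys k _ (on_indices (braid_relation n)))).

Lemma braid_relation_ideal l r t u v :
    braid_relation n l r -> indices u = l ++ t -> indices v = r ++ t ->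
  braid_ideal (<< u >> - << v >>).
Proof.
move=> lr /indices_cat[a [b [-> ea eb]]] /indices_cat[a' [b' [-> ea' eb']]].
have <- : b = b' by apply: indices_inj; rewrite eb.
rewrite -[a]mul1m -[a']mul1m; apply: in_ideal_factor.
by rewrite /on_indices ea ea'.
Qed.

Lemma braid_step_ideal s t u v : braid_step s t -> indices u = s -> indices v = t ->
  braid_ideal (<< u >> - << v >>).
Proof.
move=> st; elim: st u v => [i j r fij|i j r aij|x p q _ IH] u v eu ev.
- have := word_between_indices u; rewrite eu /= => /and3P[hi hj _].
  case/orP: fij => ij.
    rewrite -opprB; apply: in_idealN.
    apply: (braid_relation_ideal (l := [:: j; i]) (r := [:: i; j]) _ ev eu).
    by constructor => //; rewrite addn2.
  apply: (braid_relation_ideal (l := [:: i; j]) (r := [:: j; i]) _ eu ev).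
  by constructor => //; rewrite addn2.
- have := word_between_indices u; rewrite eu /= => /and3P[hi hj _].
  case/orP: aij => /eqP ij; rewrite -ij in hi hj eu ev *.
    rewrite -opprB; apply: in_idealN.
    apply: (braid_relation_ideal (l := [:: i.+1; i; i.+1])
      (r := [:: i; i.+1; i]) _ ev eu).
    by constructor; lia.
  apply: (braid_relation_ideal (l := [:: j.+1; j; j.+1])
    (r := [:: j; j.+1; j]) _ eu ev).
  by constructor; lia.
- have [a [b [-> ea eb]]] := indices_cat (s := [:: x]) eu.
  have [a' [b' [-> ea' eb']]] := indices_cat (s := [:: x]) ev.
  have <- : a = a' by apply: indices_inj; rewrite ea.
  rewrite -[mmul a b]mulm1 -[mmul a b']mulm1 -mul_binomial.
  exact/in_ideal_mul/IH.
Qed.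

(** The intermediate words of a chain of steps stay within the letters
    1, ..., n, so that each of them is a word of the free monoid. *)
Lemma braid_eq_ideal u v : braid_eq (indices u) (indices v) ->
  braid_ideal (<< u >> - << v >>).
Proof.
move es: (indices u) => s; move et: (indices v) => t st.
elim: st u v es et => [r|p q r pq _ IH] u v es et.
  have -> : u = v by apply: indices_inj; rewrite es.
  by rewrite subrr; apply: in_ideal0.
have [w ew] : exists w, indices w = q.
  by apply/indices_onto/(braid_step_between pq); rewrite -es;
     apply: word_between_indices.
rewrite -(subrKA << w >>); apply: in_idealD; last exact: IH.
exact: braid_step_ideal pq es ew.
Qed.

End Ideal.

Lemma braid_relation_GS l r : braid_relation n l r -> braid_GS_relation n l r.
Proof.
case=> [i hi|i j hj hi ij]; last by apply: BraidGSComm; lia.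
have := @BraidGS n i i.+1 [::] [::] hi.
by rewrite descS // !desc_nil //=; apply; [lia|..|left].
Qed.

End BraidWords.

Theorem theorem4p2 (k : fieldType) (n : nat) (hn : (1 <= n)%N) :
  semigroup_GS_basis k (deglex_order 'I_n)
    (on_indices (braid_relation n)) (on_indices (braid_GS_relation n)).
Proof.
split.
- exact: braid_GS_oriented.
- apply: (@confluent_GS_basis _ _ _ _ (fun u v => braid_eq (indices u) (indices v))).
  + exact: braid_GS_oriented.
  + split=> [u|u v|u v w]; [reflexivity|by symmetry|exact: braid_eq_trans].
  + move=> a u v b /braid_GS_relation_eq uv.
    by rewrite !indicesM uv.
  + move=> p q /irreducible_normal np /irreducible_normal nq pq.
    exact/indices_inj/(normal_braid_eq np nq pq).
- move=> f; split; apply: in_ideal_trans => _ [u [v [uv ->]]].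
  + exact/braid_eq_ideal/braid_GS_relation_eq/uv.
  + by apply: in_ideal_gen; exists u, v; split=> //; apply: braid_relation_GS.
Qed.
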